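(* Let $k \geq 2$ be an integer and let $G$ be a finite connected simple graph. Then $c_{H,k}(G) = 1$ if and only if $G$ is a caterpillar.
   Context: The $k$-hyperopic game of cops and robber ($k \ge 1$ an integer) on a finite connected simple graph $G$ is played by a team of cops (controlled by one player) and one robber, all occupying vertices of $G$. First the cops choose their starting vertices (several cops may share a vertex), then the robber chooses his starting vertex. Then the players alternate turns, cops first: on the cops' turn each cop stays or moves to an adjacent vertex; on the robber's turn he stays or moves to an adjacent vertex. The robber always sees the positions of all cops. The robber is invisible to the cops whenever every cop satisfies $1 \le d(r,c) \le k$, where $r$ and $c$ are the current positions of the robber and that cop and $d$ is graph distance; otherwise (in particular whenever some cop is at distance greater than $k$ from him) his position is known to all cops. The robber is omniscient: he knows the complete strategy of the cops in advance, so he is never captured by chance, i.e. a winning cop strategy must guarantee capture against every possible play of the robber. The cops win if after finitely many rounds some cop occupies the same vertex as the robber; otherwise the robber wins. The $k$-hyperopic cop number $c_{H,k}(G)$ is the minimum number of cops that have a winning strategy on $G$. A caterpillar is a tree such that if all its leaves are removed, the remaining graph is a path (possibly a single vertex; the empty graph, arising from $K_2$, is also allowed). *)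

(* Defs.v *)
From mathcomp Require Import all_boot.
From mathcomp Require Import boolp.

Set Implicit Arguments.
Unset Strict Implicit.
Unset Printing Implicit Defensive.

(** * Finite simple graphs *)

Record sgraph := SGraph {
  vertex :> finType;
  adj : rel vertex;
  adj_sym : symmetric adj;
  adj_irr : irreflexive adj }.

Section Graphs.
Variable G : sgraph.
Implicit Types (x y : G) (A : {set G}).

(* The empty graph is not connected. *)
Definition connected_graph : Prop :=
  0 < #|G| /\ forall x y, connect (@adj G) x y.

(* In a simple graph the [ucycle]s of size at most 2 are the empty sequence
   and the edges, so the cycles are exactly those of size at least 3. *)
Definition acyclic_graph : Prop :=
  forall c : seq G, ucycle (@adj G) c -> size c <= 2.

Definition is_tree : Prop := connected_graph /\ acyclic_graph.

Definition is_leaf x : bool := #|[set y | adj x y]| == 1.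

Definition has_walk n x y : bool :=
  [exists p : n.-tuple G, path (@adj G) x p && (last x p == y)].

(* Least length of a walk from [x] to [y]; distances are less than [#|G|], and
   the value is [#|G|] when there is no walk. *)
Definition dist x y : nat := find (fun n => has_walk n x y) (iota 0 #|G|).

Definition induced_adj A : rel {x : G | x \in A} :=
  fun u v => adj (val u) (val v).

Lemma induced_adj_sym A : symmetric (@induced_adj A).
Proof. by move=> u v; rewrite /induced_adj adj_sym. Qed.

Lemma induced_adj_irr A : irreflexive (@induced_adj A).
Proof. by move=> u; rewrite /induced_adj adj_irr. Qed.

Definition induced A : sgraph :=
  SGraph (@induced_adj_sym A) (@induced_adj_irr A).

(* [G] is isomorphic to the path on [n] vertices; [n = 0] and [n = 1] are
   allowed. *)
Definition is_path_graph : Prop :=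
  exists n (f : G -> 'I_n), bijective f /\
    forall x y, adj x y = ((f x).+1 == f y) || ((f y).+1 == f x).

End Graphs.

Definition caterpillar (G : sgraph) : Prop :=
  is_tree G /\ is_path_graph (induced [set x : G | ~~ is_leaf x]).

(** * The k-hyperopic game with m cops *)

Section Game.
Variables (k : nat) (G : sgraph) (m : nat).

Definition stay_or_move (x y : G) : bool := (x == y) || adj x y.

Definition cops := {ffun 'I_m -> G}.

Definition caught (c : cops) (r : G) : bool := [exists i, c i == r].

Definition invisible (c : cops) (r : G) : bool :=
  [forall i, 1 <= dist r (c i) <= k].

(* What the cops learn from a position. *)
Definition observe (c : cops) (r : G) : option G :=
  if invisible c r then None else Some r.

(* On their turn the cops know their own positions and all the observations
   made so far, in chronological order: one after the robber's placement and
   one after every turn of either side. *)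
Record cop_strategy := CopStrategy {
  cop_init : cops;
  cop_move : seq (option G) -> cops -> cops;
  cop_move_legal : forall h (c : cops) i,
    stay_or_move (c i) (cop_move h c i) }.

Definition robber_trajectory (r : nat -> G) : Prop :=
  forall t, stay_or_move (r t) (r t.+1).

(* The cops' positions and observations at the end of round [t], where round
   [0] is the placement and [r t] is the robber's vertex after round [t]. *)
Fixpoint play (s : cop_strategy) (r : nat -> G) (t : nat) :
    cops * seq (option G) :=
  if t is t'.+1 then
    let: (c, h) := play s r t' in
    let c' := cop_move s h c in
    (c', h ++ [:: observe c' (r t'); observe c' (r t)])
  else (cop_init s, [:: observe (cop_init s) (r 0)]).

Definition cops_at s r t : cops := (play s r t).1.

(* Quantifying over all trajectories after the deterministic strategy is fixed
   expresses the omniscience of the robber. Capture may occur after either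
   side's turn. *)
Definition winning (s : cop_strategy) : Prop :=
  forall r, robber_trajectory r ->
  exists t, caught (cops_at s r t) (r t) \/ caught (cops_at s r t.+1) (r t).

Definition cops_win : Prop := exists s, winning s.

End Game.

Lemma cops_win_card k (G : sgraph) : cops_win k G #|G|.
Proof.
have legal (h : seq (option G)) (c : cops G #|G|) i : stay_or_move (c i) (c i).
  by rewrite /stay_or_move eqxx.
exists (CopStrategy [ffun i => enum_val i] legal) => r _; exists 0; left.
by apply/existsP; exists (enum_rank (r 0)); rewrite ffunE enum_rankK.
Qed.

Lemma cops_win_exists k (G : sgraph) : exists m, `[< cops_win k G m >].
Proof. by exists #|G|; apply/asboolP/cops_win_card. Qed.

Definition hyperopic_cop_number k (G : sgraph) : nat :=
  ex_minn (cops_win_exists k G).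

(* Main.v *)
Require Import Defs.
From mathcomp Require Import all_boot zify.
From mathcomp Require Import boolp.

Set Implicit Arguments.
Unset Strict Implicit.
Unset Printing Implicit Defensive.

(** Why the theorem is true.

    Say that a vertex is inner when it is not a leaf.  For a connected graph,
    being a caterpillar amounts to being acyclic with at most two inner
    neighbours at every vertex: under these two conditions a longest path
    through inner vertices contains all of them ([inner_path_graph]), and the
    degree bound is read off the path directly ([path_graph_inner]).

    If [G] is a caterpillar, one cop needs no information at all.  She starts
    at an end of the spine and walks along it; at each spine vertex [c] she
    visits the leaves of [c] one by one, returning to [c] in between.  The
    territory [D] still open to the robber touches the rest of the graph only
    at the cop's post [c], so a robber who tries to slip past is caught there,
    and [D] shrinks at every stage ([sweep]).

    If [G] is not a caterpillar, a robber who knows the strategy escapes.  The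
    key remark is that at each turn he has to avoid only two vertices: the
    current one of the cop, and the one she goes to next if she does not see
    him.  If she does see him, he is more than [k] away and cannot be reached
    in one move ([unseen_move_avoids]).  On a cycle he always has three
    vertices within reach, hence a safe one ([evade_two_nbrs]).

    Near a vertex [x] with three inner neighbours he stays at [x] as long as
    the cop is not about to enter [x].  When she is, he steps into a branch
    [a - b] at [x], with [a] adjacent to [x] and [b] beyond [a].  While she
    remains around [x] every hiding place is within distance 2 of her, so
    because [k >= 2] she sees nothing, and her whole future is known to him.
    Short excursions from [x] to [a] are harmless: he waits at [b].  The only
    danger is that she goes from [x] to [a] without turning back at once; so
    he picks a branch other than the one she first leaves for in this way, and
    when she does leave, he returns to [x] behind her
    ([evade_three_branches]). *)

Lemma avoid_two (T : finType) (A : {set T}) u v : 2 < #|A| ->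
  exists a, [/\ a \in A, a != u & a != v].
Proof.
move=> A3; have : 0 < #|A :\: [set u; v]|.
  rewrite cardsD subn_gt0; apply: leq_ltn_trans (subset_leq_card (subsetIr _ _)) _.
  by rewrite cards2 (leq_ltn_trans (_ : _ <= 2)) //; case: eqP.
by case/card_gt0P => a; rewrite !inE negb_or => /andP [/andP [? ?] ?]; exists a.
Qed.

(** * Leaves, inner vertices and distances *)

Section Neighbours.
Variable G : sgraph.
Implicit Types (x y z : G).

Lemma adj_neq x y : adj x y -> x != y.
Proof. by apply: contraTneq => ->; rewrite adj_irr. Qed.

Lemma leaf_nbr_unique x y z : is_leaf x -> adj x y -> adj x z -> y = z.
Proof.
case/cards1P => w nbrE xy xz.
have: y \in [set w] by rewrite -nbrE inE.
have: z \in [set w] by rewrite -nbrE inE.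
by move=> /set1P -> /set1P ->.
Qed.

Lemma two_nbrs_inner x y z : adj x y -> adj x z -> y != z -> ~~ is_leaf x.
Proof.
by move=> xy xz; apply: contra => x_leaf; rewrite (leaf_nbr_unique x_leaf xy xz).
Qed.

Lemma inner_other_nbr x y : ~~ is_leaf y -> adj x y -> exists2 z, adj y z & z != x.
Proof.
move=> y_inner xy; apply: contrapT => none; case/negP: y_inner.
apply/cards1P; exists x; apply/setP => z; rewrite !inE.
apply/idP/eqP => [yz | ->]; last by rewrite adj_sym.
by apply/eqP/negPn/negP => z_x; apply: none; exists z.
Qed.

Definition inner_nbrs x : {set G} := [set y | adj x y & ~~ is_leaf y].

Lemma dist_le n x y : has_walk n x y -> dist x y <= n.
Proof.
move=> walk; rewrite leqNgt; apply/negP => lt_n.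
have n_lt : n < #|G| by apply: leq_trans lt_n _; rewrite -[X in _ <= X](size_iota 0) find_size.
by have /= := before_find 0 lt_n; rewrite nth_iota // add0n walk.
Qed.

Lemma dist_gt0 x y : x != y -> 0 < dist x y.
Proof.
move=> xy; rewrite /dist; case cardG: #|G| => [|n] /=.
  by have := card0_eq cardG x; rewrite inE.
case: ifP => // /existsP [p]; rewrite tuple0 /=.
by rewrite (negPf xy).
Qed.

Lemma dist_adj x y : adj x y -> dist x y <= 1.
Proof. by move=> xy; apply: dist_le; apply/existsP; exists [tuple y]; rewrite /= xy eqxx. Qed.

Lemma dist_two_steps x y z : adj x y -> stay_or_move y z -> dist x z <= 2.
Proof.
move=> xy /orP [/eqP <- | yz]; first by apply: leq_trans (dist_adj xy) _.
by apply: dist_le; apply/existsP; exists [tuple y; z]; rewrite /= xy yz eqxx.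
Qed.

End Neighbours.

(** * The game with a single cop *)

Section SingleCop.
Variables (k : nat) (G : sgraph).
Implicit Types (c : cops G 1) (r : G).

Lemma caught1 c r : caught c r = (c ord0 == r).
Proof.
by apply/existsP/idP => [[i] | ?]; [rewrite (ord1 i) | exists ord0].
Qed.

Lemma invisible1 c r : invisible k c r = (1 <= dist r (c ord0) <= k).
Proof.
by apply/forallP/idP => [/(_ ord0) // | ? i]; rewrite (ord1 i).
Qed.

Lemma observe_near c r : 2 <= k -> c ord0 != r -> dist r (c ord0) <= 2 -> observe k c r = None.
Proof.
move=> k2 cr near; rewrite /observe invisible1 dist_gt0 1?eq_sym //=.
by rewrite (leq_trans near k2).
Qed.

(** A robber seen at a vertex not occupied by the cop is at distance greater
    than [k >= 1], out of reach of her next move; so planning against the move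
    she makes when she sees nothing is enough.  [H] is the history as a
    function of the latest observation. *)
Lemma unseen_move_avoids (s : cop_strategy G 1) (H : option G -> seq (option G)) c r :
  1 <= k -> c ord0 != r -> cop_move s (H None) c ord0 != r ->
  cop_move s (H (observe k c r)) c ord0 != r.
Proof.
move=> k1 cr blind; rewrite /observe invisible1; case: ifP => // /negP far.
apply/eqP => moved; apply: far; rewrite dist_gt0 1?eq_sym //=.
have := cop_move_legal s (H (Some r)) c ord0; rewrite moved => /orP [/eqP eq_cr|].
  by rewrite eq_cr eqxx in cr.
by rewrite adj_sym => /dist_adj /leq_trans ->.
Qed.

End SingleCop.

(** * The evading robber *)

Section Evasion.
Variables (k : nat) (G : sgraph).

(** Evasion as an invariant of the positions and the history at the end of a
    round.  The robber's choices are made by the axiom of choice: they may use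
    the strategy [s] itself, which is his omniscience. *)
Lemma evasion m (s : cop_strategy G m) (Inv : cops G m -> seq (option G) -> G -> Prop) :
  (exists r, Inv (cop_init s) [:: observe k (cop_init s) r] r) ->
  (forall c h r, Inv c h r ->
     let c' := cop_move s h c in
     [/\ ~~ caught c r, ~~ caught c' r &
       exists2 r', stay_or_move r r' &
         Inv c' (h ++ [:: observe k c' r; observe k c' r']) r']) ->
  ~ winning k s.
Proof.
move=> [r0 Inv0] step win.
pose state := (cops G m * seq (option G) * G)%type.
pose good_step (st : state) (r' : G) :=
  let: (c, h, r) := st in let c' := cop_move s h c in
  Inv c h r -> stay_or_move r r' /\
    Inv c' (h ++ [:: observe k c' r; observe k c' r']) r'.
have /choice [next nextP] : forall st, exists r', good_step st r'.
  move=> [[c h] r]; have [inv|ninv] := EM (Inv c h r); last by exists r.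
  by have [_ _ [r' ? ?]] := step _ _ _ inv; exists r'.
pose advance (st : state) : state :=
  let: (c, h, r) := st in let c' := cop_move s h c in let r' := next st in
  (c', h ++ [:: observe k c' r; observe k c' r'], r').
pose st t := iter t advance (cop_init s, [:: observe k (cop_init s) r0], r0).
pose r t := (st t).2.
have rS t : r t.+1 = next (st t) by rewrite /r /= -/(st t); case: (st t) => [[c h] r'].
have stE t : st t = (play k s r t, r t).
  elim: t => [|t IH] //; rewrite [st t.+1]/= -/(st t) rS.
  by rewrite /= rS IH /=; case: (play k s r t).
have moves t : good_step (play k s r t, r t) (r t.+1) by rewrite rS -stE.
have InvP t : Inv (play k s r t).1 (play k s r t).2 (r t).
  elim: t => [|t IH] //; have := moves t.
  by rewrite /=; case: (play k s r t) IH => c h /= IH /(_ IH) [].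
have traj : robber_trajectory r.
  by move=> t; have := moves t; have := InvP t; case: (play k s r t) => c h /= ? [].
have [t] := win r traj.
have [] := step _ _ _ (InvP t); rewrite /cops_at /=.
by case: (play k s r t) => c h /= /negP ? /negP ? _ [].
Qed.

Lemma no_cop_loses : 0 < #|G| -> ~ cops_win k G 0.
Proof.
move=> /card_gt0P [x _] [s win].
have stand : robber_trajectory (fun _ : nat => x) by move=> t; rewrite /stay_or_move eqxx.
by have [t [] /existsP [[]]] := win _ stand.
Qed.

(** Among a vertex of [A] and two of its neighbours in [A], one avoids both
    the cop's position and her next unseen one. *)
Lemma evade_two_nbrs (A : {set G}) : 1 <= k -> 0 < #|A| ->
  (forall x, x \in A -> exists y z, [/\ y \in A, z \in A & [/\ adj x y, adj x z & y != z]]) ->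
  ~ cops_win k G 1.
Proof.
move=> k1 /card_gt0P [x0 x0A] degA [s].
have escape x (u v : G) : x \in A -> exists r, [/\ r \in A, u != r, v != r & stay_or_move x r].
  move=> xA; have [y [z [yA zA [xy xz yz]]]] := degA x xA.
  have [|r [rxyz ru rv]] := avoid_two (A := [set x; y; z]) u v.
    apply/card_gt2P; exists x, y, z; rewrite !inE !eqxx !orbT; split=> //.
    by rewrite adj_neq // yz eq_sym adj_neq.
  exists r; rewrite /stay_or_move (eq_sym u) (eq_sym v) ru rv.
  by move: rxyz; rewrite !inE => /orP [/orP [] |] /eqP ->; rewrite ?eqxx ?xy ?xz ?orbT.
apply: (evasion (Inv := fun c h r => [/\ r \in A, c ord0 != r & cop_move s h c ord0 != r])).
  have [r [rA ? ? _]] := escape x0 (cop_init s ord0) (cop_move s [:: None] (cop_init s) ord0) x0A.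
  exists r; split=> //.
  exact: (unseen_move_avoids (H := fun o => [:: o])).
move=> c h r [rA cr cr'] /=; rewrite !caught1; split=> //.
set c' := cop_move s h c.
have [r' [r'A ? ? ?]] :=
  escape r (c' ord0) (cop_move s (h ++ [:: observe k c' r; None]) c' ord0) rA.
exists r' => //; split=> //.
exact: (unseen_move_avoids (H := fun o => h ++ [:: observe k c' r; o])).
Qed.

Lemma cycle_evades (c : seq G) : 1 <= k -> ucycle (@adj G) c -> 2 < size c ->
  ~ cops_win k G 1.
Proof.
move=> k1 /andP [cyc uniq_c] long.
apply: (@evade_two_nbrs [set x in c]) => //.
  by case: c long {cyc uniq_c} => // x c _; apply/card_gt0P; exists x; rewrite !inE eqxx.
move=> x; rewrite inE => xc; have [i q rotE] := rot_to xc.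
have mem_q y : y \in x :: q -> y \in [set x in c] by move=> yq; rewrite inE -(mem_rot i) rotE.
have := cyc; have := uniq_c; rewrite -(rot_uniq i) -(rot_cycle i) rotE => {}uniq_c {}cyc.
move: long; rewrite -(size_rot i) rotE.
case: q {rotE} uniq_c cyc mem_q => [|y q] //; case/lastP: q => [|q z] //.
rewrite /= rcons_path last_rcons => /andP [_ /andP [y_new _]] /and3P [xy _ zx] mem_q _.
exists y, z; split; [apply: mem_q | apply: mem_q |split] => //; last first.
- by apply: contraNneq y_new => ->; rewrite mem_rcons mem_head.
- by rewrite adj_sym.
- by rewrite !inE mem_rcons mem_head !orbT.
- by rewrite !inE eqxx orbT.
Qed.

(** The cop's positions from the end of a round on, as long as she observes
    nothing; every later round contributes two empty observations. *)
Fixpoint unseen_future (s : cop_strategy G 1) h (c : cops G 1) t : G :=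
  if t is t'.+1 then unseen_future s (h ++ [:: None; None]) (cop_move s h c) t'
  else c ord0.

(** [T] is the start of the first departure of [f] from [x] that does not
    return at the next step; hiding in the branch of [a] is safe when this
    departure does not begin in [a].  The condition is void when there is no
    such departure. *)
Definition strays_elsewhere (f : nat -> G) (x a : G) := forall T,
  (forall t, t < T -> f t = x \/ f t.+1 = x) ->
  f T <> x -> f T.+1 <> x -> f T <> a.

Lemma strays_elsewhere_shift f x a : f 0 = x \/ f 1 = x ->
  strays_elsewhere f x a -> strays_elsewhere (fun t => f t.+1) x a.
Proof. by move=> near stray T before; apply: stray => -[|t] // /before. Qed.

(** The first departure is unique, so it rules out at most one branch. *)
Lemma strays_elsewhere_but_one f x :
  exists y, forall a, a != y -> strays_elsewhere f x a.
Proof.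
have [[T [before fT fT']]|never] := EM (exists T,
    [/\ forall t, t < T -> f t = x \/ f t.+1 = x, f T <> x & f T.+1 <> x]).
  exists (f T) => a /eqP aT T' before' fT1 fT1'.
  case: (ltngtP T T') => [/before' [] | /before [] | <- ] // Ta.
  exact: aT.
by exists x => a _ T before fT fT'; case: never; exists T.
Qed.

(** At most two of the three branches are unusable when the robber has to
    leave [x]: the one the cop comes from and the one she first departs
    into. *)
Lemma evade_three_branches (x : G) : 2 <= k -> 2 < #|inner_nbrs x| -> ~ cops_win k G 1.
Proof.
move=> k2 branches [s].
have k1 : 1 <= k by apply: leq_trans k2.
have branch u v : exists a b,
    [/\ adj x a, adj a b, b != x & (a != u) /\ (a != v)].
  have [a [+ au av]] := avoid_two u v branches; rewrite inE => /andP [xa inner].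
  by have [b ab bx] := inner_other_nbr inner xa; exists a, b.
(* Positions at the end of a round.  When safe, the robber holds [x].  When
   hidden, he is at [a], or at [b] if the cop is in [a] or about to enter it,
   and the cop is at [x] or turns back to [x] on her next move. *)
pose safe (c : cops G 1) h r :=
  [/\ r = x, c ord0 != x & cop_move s h c ord0 != x].
pose hidden (c : cops G 1) h r := exists a b,
  [/\ [/\ adj x a, adj a b & b != x],
     stay_or_move (c ord0) x,
     c ord0 = x \/ cop_move s h c ord0 = x,
     strays_elsewhere (unseen_future s h c) x a &
     r = if (c ord0 == a) || (cop_move s h c ord0 == a) then b else a].
have hide_unseen (c : cops G 1) h (a b : G) :
    adj x a -> adj a b -> b != x -> stay_or_move (c ord0) x ->
    c ord0 = x \/ cop_move s h c ord0 = x ->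
    let r := if (c ord0 == a) || (cop_move s h c ord0 == a) then b else a in
    [/\ c ord0 != r, cop_move s h c ord0 != r, observe k c r = None &
       observe k (cop_move s h c) r = None].
  move=> xa ab bx cx cc'; set c' := cop_move s h c.
  have c'x : stay_or_move x (c' ord0).
    case: cc' => [<- | ->]; first exact: cop_move_legal.
    by rewrite /stay_or_move eqxx.
  have xc : stay_or_move x (c ord0) by rewrite /stay_or_move eq_sym adj_sym.
  have ax : adj a x by rewrite adj_sym.
  have ba : adj b a by rewrite adj_sym.
  have ab' := adj_neq ab; have xa' := adj_neq xa.
  have [near_ba near_bx] : dist b a <= 2 /\ dist b x <= 2.
    by split; apply: dist_two_steps ba _; rewrite /stay_or_move ?eqxx ?ax ?orbT.
  case: (eqVneq (c ord0) a) => [ca | ca] /=.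
    have c'E : c' ord0 = x by case: cc' => // cx'; rewrite -cx' ca eqxx in xa'.
    by split; rewrite ?observe_near ?c'E ?ca // eq_sym.
  case: (eqVneq (c' ord0) a) => [c'a | c'a] /=.
    have cE : c ord0 = x by case: cc' => // cx'; rewrite -cx' c'a eqxx in xa'.
    by split; rewrite ?observe_near ?c'a ?cE // eq_sym.
  by split; rewrite ?observe_near //; apply: dist_two_steps ax _.
have enter (c : cops G 1) h : stay_or_move (c ord0) x ->
    c ord0 = x \/ cop_move s h c ord0 = x ->
    exists r, [/\ hidden c h r, observe k c r = None &
      cop_move s h c ord0 = x -> adj x r].
  move=> cx cc'; have [y yP] := strays_elsewhere_but_one (unseen_future s h c) x.
  have [a [b [xa ab bx [ac /yP ay]]]] := branch (c ord0) y.
  have [_ _ unseen _] := hide_unseen c h a b xa ab bx cx cc'.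
  exists (if (c ord0 == a) || (cop_move s h c ord0 == a) then b else a); split=> //.
    by exists a, b.
  by move=> ->; rewrite eq_sym (negPf ac) (negPf (adj_neq xa)).
apply: (evasion (Inv := fun c h r => safe c h r \/ hidden c h r)).
  (* The robber starts at [x] if the cop is neither there nor about to be. *)
  have [c'x | c'x] := eqVneq (cop_move s [:: None] (cop_init s) ord0) x.
    have [|| r [hid unseen _]] := enter (cop_init s) [:: None]; last 1 first.
    - by exists r; right; rewrite unseen.
    - by rewrite -c'x; apply: cop_move_legal.
    - by right.
  have [cx | cx] := eqVneq (cop_init s ord0) x.
    have [|| r [hid unseen _]] := enter (cop_init s) [:: None]; last 1 first.
    - by exists r; right; rewrite unseen.
    - by rewrite /stay_or_move cx eqxx.
    - by left.
  exists x; left; split=> //.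
  exact: (unseen_move_avoids (H := fun o => [:: o])).
move=> c h r [[-> cx c'x] | [a [b [[xa ab bx] cx cc' stray rE]]]] /=; set c' := cop_move s h c.
  rewrite !caught1; split=> //.
  set o := observe k c' x.
  have [c''x | c''x] := eqVneq (cop_move s (h ++ [:: o; None]) c' ord0) x.
    have [|| r' [hid unseen /(_ c''x) xr']] := enter c' (h ++ [:: o; None]).
    - by rewrite -c''x; apply: cop_move_legal.
    - by right.
    by exists r'; [rewrite /stay_or_move xr' orbT | right; rewrite unseen].
  exists x; first by rewrite /stay_or_move eqxx.
  left; split=> //.
  exact: (unseen_move_avoids (H := fun o' => h ++ [:: o; o'])).
have [cr c'r _] := hide_unseen c h a b xa ab bx cx cc'.
rewrite -rE !caught1 in cr c'r *; rewrite -/c' => -> ; split=> //.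
have c'near : stay_or_move (c' ord0) x.
  case: cc' => [<- | ->]; last by rewrite /stay_or_move eqxx.
  by have := cop_move_legal s h c ord0; rewrite /stay_or_move eq_sym adj_sym.
set h' := h ++ [:: None; None]; set c'' := cop_move s h' c'.
(* Either the cop stays around [x] and the robber remains hidden, or she
   departs into another branch and he returns to [x] behind her. *)
have [back | away] := EM (c' ord0 = x \/ c'' ord0 = x).
  have [_ _ unseen _] := hide_unseen c' h' a b xa ab bx c'near back.
  exists (if (c' ord0 == a) || (c'' ord0 == a) then b else a).
    by rewrite rE /stay_or_move; case: ifP; case: ifP; rewrite ?eqxx ?ab ?(adj_sym b) ?ab ?orbT.
  right; rewrite unseen; exists a, b; split=> //.
  exact: strays_elsewhere_shift stray.
have c'x : c' ord0 != x by apply/eqP => ?; apply: away; left.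
have c''x : c'' ord0 != x by apply/eqP => ?; apply: away; right.
have c'a : c' ord0 != a.
  by apply/eqP; apply: (stray 1) => [[] // | |]; apply/eqP.
have cE : c ord0 = x by case: cc' => // /eqP; rewrite (negPf c'x).
have ra : r = a.
  by rewrite rE cE (negPf (adj_neq xa)) /= -/c' (negPf c'a).
exists x; first by rewrite ra /stay_or_move adj_sym xa orbT.
left; rewrite observe_near //.
rewrite (leq_trans (dist_adj _)) //.
by have := cop_move_legal s h c ord0; rewrite cE /stay_or_move -/c' eq_sym (negPf c'x).
Qed.
End Evasion.

(** * The sweeping cop *)

Section Sweep.
Variables (k : nat) (G : sgraph).

Definition walk (w : nat -> G) : Prop := forall t, stay_or_move (w t) (w t.+1).

Definition intercepts (w r : nat -> G) : Prop :=
  exists t, w t = r t \/ w t.+1 = r t.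

Lemma intercepts_cons c (w r : nat -> G) :
  intercepts w (fun t => r t.+1) -> intercepts (fun t => if t is t'.+1 then w t' else c) r.
Proof. by move=> [t eq_t]; exists t.+1. Qed.

(** A cop following a fixed walk only needs to know the time, which is half
    the length of the history. *)
Lemma blind_walk_wins (w : nat -> G) : walk w ->
  (forall r, robber_trajectory r -> intercepts w r) -> cops_win k G 1.
Proof.
move=> walk_w catch.
pose follow (h : seq (option G)) (c : cops G 1) : cops G 1 :=
  (* Legality is required in every position, also off the walk, where the cop
     stays put. *)
  let t := (size h)./2 in if c ord0 == w t then [ffun=> w t.+1] else c.
have legal h (c : cops G 1) i : stay_or_move (c i) (follow h c i).
  rewrite (ord1 i) /follow; case: eqP => [-> | _]; first by rewrite ffunE.
  by rewrite /stay_or_move eqxx.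
pose s := CopStrategy [ffun=> w 0] legal.
have playE r t : cops_at k s r t = [ffun=> w t] /\ size (play k s r t).2 = t.*2.+1.
  rewrite /cops_at; elim: t => [|t] //=.
  case: (play k s r t) => c h /= [-> szh]; rewrite size_cat szh addn2 doubleS; split=> //.
  by rewrite /follow szh /= uphalf_double ffunE eqxx.
exists s => r /catch [t eq_t]; exists t.
by rewrite !caught1 !(playE r _).1 !ffunE; case: eq_t => ->; rewrite eqxx; [left | right].
Qed.

Hypothesis conn : forall x y : G, connect (@adj G) x y.
Hypothesis two_branches : forall x : G, #|inner_nbrs x| <= 2.

(** [D] is the territory still open to the robber.  Its only exit is the cop's
    post [c], and the spine continues into [D] in at most one direction.  If
    [c] has a leaf in [D], going there and back removes it from [D]: the
    robber can use the cop's absence only by stepping on [c], where he is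
    caught on her return.  Otherwise she advances to the unique neighbour [d]
    of [c] in [D], which any robber leaving [D] would have to cross.  The last
    hypothesis makes [c] an inner neighbour of [d] outside [D], so that at
    most one remains ahead of [d]. *)
Lemma sweep (D : {set G}) (c : G) :
  c \notin D ->
  (forall d y, d \in D -> adj d y -> y \in D \/ y = c) ->
  {in D &, forall y z, y \in inner_nbrs c -> z \in inner_nbrs c -> y = z} ->
  (forall y, y \in D -> y \in inner_nbrs c -> ~~ is_leaf c) ->
  exists w, [/\ w 0 = c, walk w &
    forall r, robber_trajectory r -> r 0 \in D -> intercepts w r].
Proof.
have [n] := ubnP #|D|; elim: n D c => // n IH D c /ltnSE leDn cD boundary ahead c_inner.
have [-> | [d0 d0D]] := set_0Vmem D.
  by exists (fun=> c); split=> [||r _]; rewrite ?inE // => t; rewrite /stay_or_move eqxx.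
have [d dD cd] : exists2 d, d \in D & adj c d.
  have [p + lastp] := connectP (conn d0 c).
  elim: p d0 d0D lastp => [|y p IHp] d dD /= cE; first by rewrite cE dD in cD.
  case/andP => dy yp; have [yD | yc] := boundary d y dD dy; first exact: IHp yD cE yp.
  by exists d => //; rewrite adj_sym -yc.
have shrink e : e \in D -> #|D :\ e| < n.
  by move=> eD; apply: leq_trans leDn; rewrite [X in _ < X](cardsD1 e) eD.
have cons_walk a (w : nat -> G) : stay_or_move a (w 0) -> walk w ->
    walk (fun t => if t is t'.+1 then w t' else a).
  by move=> aw ww [|t] /=.
have [[l [lD cl l_leaf]] | no_leaf] := EM (exists l, [/\ l \in D, adj c l & is_leaf l]).
  have l_nbr y : adj l y -> y = c.
    by move=> ly; apply: (leaf_nbr_unique l_leaf ly); rewrite adj_sym.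
  have [|||||w [w0 ww catch]] := IH (D :\ l) c.
  - exact: shrink.
  - by rewrite !inE (negPf cD) andbF.
  - move=> e y; rewrite !inE => /andP [el eD] ey.
    case: (boundary e y eD ey) => [yD | ->]; last by right.
    have [yl | yl] := eqVneq y l; last by left.
    by move: cD; rewrite -(l_nbr e) ?eD // -yl adj_sym.
  - by move=> y z /setD1P [_ yD] /setD1P [_ zD]; apply: ahead.
  - by move=> y /setD1P [_]; apply: c_inner.
  exists (fun t => if t is t'.+1 then (if t' is t''.+1 then w t'' else l) else c); split=> //.
    apply: (cons_walk c (fun t => if t is t'.+1 then w t' else l)); first by rewrite /stay_or_move cl orbT.
    by apply: cons_walk ww; rewrite w0 /stay_or_move adj_sym cl orbT.
  move=> r traj r0D.
  have [r0l | r0l] := eqVneq (r 0) l; first by exists 0; right.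
  have [r1l | r1l] := eqVneq (r 1) l; first by exists 1; left.
  have [r1c | r1c] := eqVneq (r 1) c; first by exists 1; right; rewrite w0.
  have [r2c | r2c] := eqVneq (r 2) c; first by exists 2; left; rewrite w0.
  have r1D : r 1 \in D.
    case/orP: (traj 0) => [/eqP <- // | /(boundary _ _ r0D) [] // r1c'].
    by rewrite r1c' eqxx in r1c.
  have r2D : r 2 \in D :\ l.
    case/orP: (traj 1) => [/eqP <- | r12]; first by rewrite !inE r1l.
    have [r2l | r2l] := eqVneq (r 2) l.
      by move: r1c; rewrite (l_nbr (r 1)) ?eqxx // -r2l adj_sym.
    by rewrite !inE r2l; case: (boundary _ _ r1D r12) => // r2c'; rewrite r2c' eqxx in r2c.
  apply: (@intercepts_cons c (fun t => if t is t'.+1 then w t' else l) r).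
  apply: (@intercepts_cons l w (fun t => r t.+1)).
  by apply: catch => // t; apply: traj.
have inner_ahead y : y \in D -> adj c y -> y \in inner_nbrs c.
  by move=> yD cy; rewrite inE cy; apply/negP => y_leaf; apply: no_leaf; exists y.
have only_d y : y \in D -> adj c y -> y = d.
  by move=> yD cy; apply: ahead => //; apply: inner_ahead.
have d_inner : d \in inner_nbrs c by apply: inner_ahead.
have cd' : stay_or_move c d by rewrite /stay_or_move cd orbT.
have boundary' e y : e \in D :\ d -> adj e y -> y \in D :\ d \/ y = d.
  rewrite !inE => /andP [ed eD] ey.
  have [-> | yd] := eqVneq y d; [by right | left].
  case: (boundary e y eD ey) => // yc; move: ed.
  by rewrite (only_d e) ?eqxx // -yc adj_sym.
have [|||||w [w0 ww catch]] := IH (D :\ d) d.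
- exact: shrink.
- by rewrite !inE eqxx.
- exact: boundary'.
- move=> y z /setD1P [_ yD] /setD1P [_ zD] dy dz; apply: contrapT => /eqP yz.
  suff : 2 < #|inner_nbrs d| by rewrite ltnNge two_branches.
  apply/card_gt2P; exists c, y, z; split; split=> //.
  + by rewrite inE adj_sym cd (c_inner d).
  + by apply: contraNneq cD => ->.
  + by apply: contraNneq cD => <-.
- by move=> _ _ _; move: d_inner; rewrite inE => /andP [].
exists (fun t => if t is t'.+1 then w t' else c); split=> //.
  by apply: cons_walk ww; rewrite w0.
move=> r traj r0D.
have [r0d | r0d] := eqVneq (r 0) d; first by exists 0; right; rewrite w0.
have [r1d | r1d] := eqVneq (r 1) d; first by exists 1; left; rewrite w0.
have r0D' : r 0 \in D :\ d by rewrite !inE r0d.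
apply: (@intercepts_cons c w r); apply: catch => [t|]; first exact: traj.
case/orP: (traj 0) => [/eqP <- // | /(boundary' _ _ r0D') [] // r1d'].
by rewrite r1d' eqxx in r1d.
Qed.

End Sweep.

(** * Caterpillars *)

Section Caterpillars.
Variable G : sgraph.

Notation inner := [set x : G | ~~ is_leaf x].

Lemma path_graph_inner : is_path_graph (induced inner) ->
  (forall x : G, #|inner_nbrs x| <= 2) /\
  ((forall x : G, is_leaf x) \/
   exists2 c : G, ~~ is_leaf c & {in inner_nbrs c &, forall y z, y = z}).
Proof.
move=> [n [f [/bij_inj f_inj adjE]]].
pose sub x (hx : x \in inner) : induced inner := exist _ x hx.
have adj_pos x y (hx : x \in inner) (hy : y \in inner) : adj x y ->
    (f (sub x hx)).+1 = f (sub y hy) \/ (f (sub y hy)).+1 = f (sub x hx).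
  by move=> xy; have := adjE (sub x hx) (sub y hy); rewrite /= /induced_adj /= xy;
     case/esym/orP => /eqP; [left | right].
have pos_inj x y (hx : x \in inner) (hy : y \in inner) :
    f (sub x hx) = f (sub y hy) :> nat -> x = y.
  by move=> /val_inj /f_inj [].
have nbr_inner x y : y \in inner_nbrs x -> y \in inner by rewrite !inE => /andP [].
have nbr_adj (x y : G) : y \in inner_nbrs x -> adj x y by rewrite inE => /andP [].
split=> [x|].
  rewrite leqNgt; apply/negP => /card_gt2P [y [z [t [[yx zx tx] []]]]].
  move=> /eqP yz /eqP zt /eqP ty.
  have [x_leaf | x_in] := boolP (is_leaf x).
    by apply: yz; apply: leaf_nbr_unique x_leaf _ _; apply: nbr_adj.
  have hx : x \in inner by rewrite inE.
  have hy := nbr_inner _ _ yx; have hz := nbr_inner _ _ zx; have ht := nbr_inner _ _ tx.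
  have [Py Pz Pt] := And3 (adj_pos _ _ hx hy (nbr_adj _ _ yx))
    (adj_pos _ _ hx hz (nbr_adj _ _ zx)) (adj_pos _ _ hx ht (nbr_adj _ _ tx)).
  have Nyz : f (sub y hy) <> f (sub z hz) :> nat by move/pos_inj.
  have Nzt : f (sub z hz) <> f (sub t ht) :> nat by move/pos_inj.
  have Nty : f (sub t ht) <> f (sub y hy) :> nat by move/pos_inj.
  lia.
have [[x hx]|none] := EM (exists x, x \in inner); last first.
  by left=> x; apply/negPn/negP => x_in; apply: none; exists x; rewrite inE.
(* The inner vertex of least position is an end of the spine: positions of
   adjacent vertices differ by one. *)
right; pose least := [arg min_(u < sub x hx) (f u : nat)].
have leastP u : f least <= f u by rewrite /least; case: arg_minnP => // i _; apply.
case: least leastP => c hc leastP; exists c; first by have := hc; rewrite inE.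
move=> y z yc zc; have hy := nbr_inner _ _ yc; have hz := nbr_inner _ _ zc.
apply: (pos_inj y z hy hz); have := leastP (sub y hy); have := leastP (sub z hz).
have := adj_pos _ _ hc hy (nbr_adj _ _ yc); have := adj_pos _ _ hc hz (nbr_adj _ _ zc).
rewrite /sub; lia.
Qed.

(** A chord would close up the segment between its ends into a cycle. *)
Lemma no_chord (x0 : G) p i j : acyclic_graph G -> uniq p -> sorted (@adj G) p ->
  i.+1 < j -> j < size p -> ~~ adj (nth x0 p i) (nth x0 p j).
Proof.
move=> acyc uniq_p sorted_p ij jp; apply/negP => chord.
have ip : i < size p by lia.
have dropE : drop i p = nth x0 p i :: drop i.+1 p by rewrite -drop_nth.
pose q := take (j - i) (drop i.+1 p).
have cE : nth x0 p i :: q = take (j - i).+1 (drop i p) by rewrite dropE.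
have szq : size q = j - i by rewrite size_takel // size_drop; lia.
have lastq : last (nth x0 p i) q = nth x0 p j.
  rewrite (last_nth x0) szq cE nth_take // nth_drop; congr nth; lia.
suff cyc : ucycle (@adj G) (nth x0 p i :: q) by have := acyc _ cyc; rewrite /= szq; lia.
apply/andP; split; last by rewrite cE take_uniq ?drop_uniq.
rewrite /= rcons_path lastq adj_sym chord andbT.
suff : sorted (@adj G) (nth x0 p i :: q) by [].
by rewrite cE take_sorted ?drop_sorted.
Qed.

(** The exit vertex is inner because it is either the end of the path or has
    two distinct neighbours on it. *)
Lemma first_exit (p : pred G) a q : path (@adj G) a q -> uniq (a :: q) ->
  p a -> ~~ p (last a q) -> ~~ is_leaf (last a q) ->
  exists y z, [/\ p y, ~~ p z, adj y z & ~~ is_leaf z].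
Proof.
elim: q a => [|b q IHq] a /=; first by move=> _ _ ->.
move=> /andP [ab bq] /andP [abq uq] pa lastp last_in.
have [pb | pb] := boolP (p b); first exact: IHq bq uq pb lastp last_in.
exists a, b; split=> //.
case: q bq abq {uq lastp IHq} last_in => [|c q] //= /andP [bc _] abq _.
apply: (@two_nbrs_inner _ b a c) => //; first by rewrite adj_sym.
by apply: contraNneq abq => ->; rewrite !inE eqxx orbT.
Qed.

(** If a longest inner path missed an inner vertex, connectedness would give
    an inner vertex off the path adjacent to one of its vertices; this extends
    the path if that vertex is an end, and otherwise gives it three inner
    neighbours. *)
Lemma inner_path_graph : connected_graph G -> acyclic_graph G ->
  (forall x : G, #|inner_nbrs x| <= 2) -> is_path_graph (induced inner).
Proof.
move=> [_ conn] acyc two_branches.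
pose ipath (p : seq G) := [/\ uniq p, sorted (@adj G) p & {subset p <= inner}].
have [p [uniq_p sorted_p p_in] longest] :
    exists2 p, ipath p & forall q, ipath q -> size q <= size p.
  have ex : exists n, `[< exists2 p, ipath p & size p = n >].
    by exists 0; apply/asboolP; exists [::].
  have bound n : `[< exists2 p, ipath p & size p = n >] -> n <= #|G|.
    by case/asboolP => p [uniq_p _ _] <-; rewrite -(card_uniqP uniq_p) max_card.
  have [n /asboolP [p ip <-] longest] := ex_maxnP ex bound.
  by exists p => // q iq; apply: longest; apply/asboolP; exists q.
have p_all v : v \in inner -> v \in p.
  move=> v_in; apply: contrapT => /negP vp.
  have [y [z [yp zp yz z_in]]] :
      exists y z, [/\ y \in p, z \notin p, adj y z & ~~ is_leaf z].
    case E: p => [|a q].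
      have : ipath [:: v] by split=> // x; rewrite inE => /eqP ->.
      by move/longest; rewrite E.
    rewrite -E; have ap : a \in p by rewrite E mem_head.
    have [q' pq' lastE] := connectP (conn a v).
    case: (shortenP pq') lastE => r pr ur _ lastE.
    apply: (first_exit (p := [in p]) pr ur ap); rewrite -lastE //.
    by move: v_in; rewrite inE.
  have zin : z \in inner by rewrite inE.
  have z_inner x : x \in z :: p -> x \in inner.
    by rewrite inE => /orP [/eqP -> // | /p_in].
  case/splitPr: yp uniq_p sorted_p p_in longest zp z_inner => p1 p2 uniq_p sorted_p p_in longest zp z_inner.
  case/lastP: p1 => [|p1 l] in uniq_p sorted_p p_in longest zp z_inner *.
    suff /longest : ipath (z :: y :: p2) by rewrite /= ltnn.
    by split=> //=; rewrite ?zp // adj_sym yz.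
  case: p2 => [|r p2] in uniq_p sorted_p p_in longest zp z_inner *.
    suff /longest : ipath (rcons (rcons p1 l ++ [:: y]) z) by rewrite size_rcons ltnn.
    split=> [||x]; last by rewrite mem_rcons; apply: z_inner.
      by rewrite rcons_uniq zp.
    by rewrite -cats1 -catA /= sorted_cat_cons -cats1 sorted_p /= yz.
  move: sorted_p; rewrite cat_rcons sorted_cat_cons /= => /andP [_ /and3P [ly yr _]].
  suff : 2 < #|inner_nbrs y| by rewrite ltnNge two_branches.
  have lp : l \in rcons p1 l ++ [:: y, r & p2] by rewrite cat_rcons mem_cat mem_head orbT.
  have rp : r \in rcons p1 l ++ [:: y, r & p2] by rewrite mem_cat !inE eqxx !orbT.
  have := p_in _ lp; have := p_in _ rp; rewrite !inE => r_in l_in.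
  apply/card_gt2P; exists l, r, z; rewrite !inE -(adj_sym l) ly yr yz l_in r_in z_in; split=> //.
  split; last 2 first.
  - by apply: contraNneq zp => <-.
  - by apply: contraNneq zp => ->.
  apply: contraTneq uniq_p => ->; rewrite cat_uniq /= !mem_rcons mem_head.
  by rewrite orbT andbF.
have pos_lt (u : induced inner) : index (val u) p < size p by rewrite index_mem p_all // (valP u).
exists (size p), (fun u : induced inner => Ordinal (pos_lt u)); split.
  have tnth_in (i : 'I_(size p)) : tnth (in_tuple p) i \in inner by apply/p_in/mem_tnth.
  exists (fun i => exist _ (tnth (in_tuple p) i) (tnth_in i) : induced inner) => [u | i].
    by apply: val_inj; rewrite /= (tnth_nth (val u)) /= nth_index // p_all // (valP u).
  apply: val_inj; rewrite /= (tnth_nth (tnth (in_tuple p) i)) /= index_uniq //.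
move=> u v; rewrite [adj u v]/= /induced_adj /=.
have [up vp] : val u \in p /\ val v \in p by rewrite !p_all // (valP u, valP v).
have nth_u := nth_index (val u) up; have nth_v := nth_index (val u) vp.
apply/idP/orP => [uv|].
  case: (ltngtP (index (val u) p) (index (val v) p)) => [lt_uv | lt_vu | eq_uv].
  - left; apply: contraLR uv => succ; rewrite -nth_u -nth_v.
    by apply: no_chord; rewrite ?index_mem // ltn_neqAle succ.
  - right; apply: contraLR uv => succ; rewrite adj_sym -nth_u -nth_v.
    by apply: no_chord; rewrite ?index_mem // ltn_neqAle succ.
  - by move: uv; rewrite -nth_u -nth_v eq_uv adj_irr.
have steps := sortedP (val u) sorted_p.
case=> /eqP succ; rewrite -nth_u -nth_v -succ; last rewrite adj_sym;
  by apply: steps; rewrite succ index_mem.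
Qed.
End Caterpillars.

Theorem theorem2p8 (k : nat) (G : sgraph) (hk : 2 <= k)
    (hG : connected_graph G) :
  hyperopic_cop_number k G = 1 <-> caterpillar G.
Proof.
have [nonempty conn] := hG; have k1 : 1 <= k by apply: leq_trans hk.
have oneE : hyperopic_cop_number k G = 1 <-> cops_win k G 1.
  rewrite /hyperopic_cop_number; case: ex_minnP => m /asboolP win_m minimal.
  split=> [<- // | win1]; case: m win_m minimal => [/no_cop_loses // | m] _ minimal.
  by apply/eqP; rewrite eqn_leq minimal //; apply/asboolP.
rewrite oneE; split=> [win | [_ /path_graph_inner [two_branches start]]].
  have acyc : acyclic_graph G.
    by move=> c cyc; rewrite leqNgt; apply/negP => long; exact: (cycle_evades k1 cyc long win).
  split=> //; apply: inner_path_graph => // x.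
  by rewrite leqNgt; apply/negP => branches; exact: (evade_three_branches hk branches win).
have [c [c_end c_inner]] : exists c : G, {in inner_nbrs c &, forall y z, y = z} /\
    (forall y, y \in inner_nbrs c -> ~~ is_leaf c).
  case: start => [all_leaf | [c c_in c_end]]; last by exists c.
  have [c _] := card_gt0P nonempty; exists c.
  by split=> [y z | y]; rewrite inE all_leaf andbF.
have [||||w [w0 ww catch]] := sweep conn two_branches (D := [set~ c]) (c := c).
- by rewrite !inE eqxx.
- by move=> d y _ _; rewrite !inE; case: eqVneq; [right | left].
- by move=> y z _ _; apply: c_end.
- by move=> y _; apply: c_inner.
apply: (@blind_walk_wins k G w ww) => r traj.
have [r0c | r0c] := eqVneq (r 0) c; first by exists 0; left; rewrite w0.
by apply: catch; rewrite // !inE.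
Qed.
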